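(* Let $\mathcal C=(x,y,z)$ be a non-degenerate spherical conic in canonical position, that is, $\mathcal C=\mathcal{CV}_{AB}$ or $\mathcal C=\mathcal{CH}_{CD}$ with admissible parameters. Then its spherical angular momentum $\mathcal K$ can be written as a function of $z$ in the form $$\mathcal K(z)^2=\frac{z^2}{\mu+c\,z^2},$$ where $\mu\neq0$ and $c\neq0$ are given by $$\mu=\frac{(A^2-1)(1-B^2)}{A^2B^2},\qquad c=\frac1{A^2B^2}\qquad\text{for }\mathcal{CV}_{AB},$$ $$\mu=\frac{D^4(1-C^2)}{C^2(1-D^2)^2},\qquad c=\frac{C^2-D^2}{C^2(1-D^2)^2}\qquad\text{for }\mathcal{CH}_{CD}.$$ Moreover: (1) for the spherical hyperbolas of type I: $\mu<0$, $\mu+c>1$ and $(\mu-c+1)^2+4c\mu>0$; if, in addition, it is a spherical parabola, then also $2\mu+c=2$ and $c>4$; (2) for the spherical hyperbolas and ellipses of type II: $\mu>0$ and $c>0$; if, in addition, it is a spherical parabola, then also $\mu+c=1$; (3) for the spherical ellipses of type III: $\mu>0$ and $c<0$.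
   Context: $\mathbb S^2\subset\mathbb R^3$ is the unit sphere. For a unit-speed curve $\xi=(x,y,z)$ in $\mathbb S^2$, its spherical angular momentum (with respect to the equator $z=0$) is $\mathcal K=\dot x\,y-x\,\dot y$ (derivatives with respect to arc length); it is well defined up to sign (orientation), and is invariant under rotations of $\xi$ around the $z$-axis. Spherical conics in canonical position are, for $A,B,C,D>0$, $$\mathcal{CV}_{AB}=\mathbb S^2\cap\Big\{\tfrac{x^2}{A^2}+\tfrac{y^2}{B^2}=1\Big\},\qquad \mathcal{CH}_{CD}=\mathbb S^2\cap\Big\{\tfrac{x^2}{C^2}+\tfrac{z^2}{D^2}=1\Big\}.$$ They are non-degenerate (the admissible parameters) when $\min\{A,B\}<1$, $A\ne B$, $A\neq1$, $B\neq1$, respectively $\min\{C,D\}<1$, $C\neq D$, $C\neq1$, $D\neq1$. The types are: - Type I (spherical hyperbolas with foci on the zero-meridian $y=0$, equidistant from the equator): $\mathcal{CV}_{AB}$ with $B<A<1$ (the case $A<B<1$ reduces to it by a $\pi/2$-rotation around the $z$-axis), equivalently $\mathcal{CH}_{CD}$ with $D<1<C$. It is called a spherical parabola when $A^2=1/2>B^2$, equivalently $C^2+D^2=2C^2D^2$. - Type II: $\mathcal{CV}_{AB}$ with $B<1<A$, equivalently $\mathcal{CH}_{CD}$ with $D<C<1$ (spherical hyperbolas with foci on the equator), or $\mathcal{CV}_{AB}$ with $A<1<B$ (spherical ellipses with foci on the equator, which are $\pi/2$-rotations around the $z$-axis of the previous ones). It is called a spherical parabola when $A^2+B^2=2A^2B^2$,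 equivalently (for $D<C<1$) $C^2=1/2>D^2$. - Type III (spherical ellipses with foci on the zero-meridian, equidistant from the equator): $\mathcal{CH}_{CD}$ with $C<1<D$ (the case $C<D<1$ reduces to it by a $\pi/2$-rotation around the $z$-axis). *)

(* Defs.v *)
From mathcomp Require Import all_boot all_order all_algebra.
From mathcomp Require Import all_classical all_reals all_analysis.

Set Implicit Arguments.
Unset Strict Implicit.
Unset Printing Implicit Defensive.

Import Order.TTheory GRing.Theory Num.Theory.
Import numFieldNormedType.Exports.

Local Open Scope ring_scope.
Local Open Scope classical_set_scope.

Definition sphere (R : realType) : set (R * R * R) :=
  [set p | let: (x, y, z) := p in x ^+ 2 + y ^+ 2 + z ^+ 2 = 1].

(* The parameters of a spherical conic in canonical position: [CV A B] is cut
   out by the cylinder over an ellipse of the xy-plane, [CH C D] by the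
   cylinder over an ellipse of the xz-plane. *)
Variant conic (R : Type) : Type := CV of R & R | CH of R & R.

Definition conic_set (R : realType) (q : conic R) : set (R * R * R) :=
  match q with
  | CV A B => @sphere R `&` [set p | let: (x, y, z) := p in
                x ^+ 2 / A ^+ 2 + y ^+ 2 / B ^+ 2 = 1]
  | CH C D => @sphere R `&` [set p | let: (x, y, z) := p in
                x ^+ 2 / C ^+ 2 + z ^+ 2 / D ^+ 2 = 1]
  end.

(* Positive parameters of a non-degenerate conic; the conditions are the same
   for both families. *)
Definition admissible (R : realType) (q : conic R) : Prop :=
  match q with
  | CV A B | CH A B =>
      [/\ 0 < A, 0 < B & [/\ Num.min A B < 1, A != B, A != 1 & B != 1]]
  end.

(* Unit-speed curves in the sphere, parametrized by an open interval [I];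
   [x], [y], [z] are irrelevant outside [I]. Differentiability is the only
   regularity required. *)
Definition unit_speed_curve (R : realType) (I : set R) (x y z : R -> R) :
    Prop :=
  [/\ open I, is_interval I &
      forall s, I s ->
        [/\ derivable x s 1, derivable y s 1, derivable z s 1,
            sphere (x s, y s, z s) &
            (derive1 x s) ^+ 2 + (derive1 y s) ^+ 2 + (derive1 z s) ^+ 2 = 1]].

Definition angular_momentum (R : realType) (x y : R -> R) (s : R) : R :=
  derive1 x s * y s - x s * derive1 y s.

Definition conic_mu (R : realType) (q : conic R) : R :=
  match q with
  | CV A B => (A ^+ 2 - 1) * (1 - B ^+ 2) / (A ^+ 2 * B ^+ 2)
  | CH C D => D ^+ 4 * (1 - C ^+ 2) / (C ^+ 2 * (1 - D ^+ 2) ^+ 2)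
  end.

Definition conic_c (R : realType) (q : conic R) : R :=
  match q with
  | CV A B => 1 / (A ^+ 2 * B ^+ 2)
  | CH C D => (C ^+ 2 - D ^+ 2) / (C ^+ 2 * (1 - D ^+ 2) ^+ 2)
  end.

(* The types are given by parameter ranges, meant for admissible parameters.
   Ranges that differ by a rotation of angle pi/2 around the z-axis are put
   in the same type; this is the reason for the disjunctions. *)

(* Spherical hyperbolas with foci on the zero-meridian y = 0. *)
Definition type_I (R : realType) (q : conic R) : Prop :=
  match q with
  | CV A B => B < A < 1 \/ A < B < 1
  | CH C D => D < 1 < C
  end.

(* Spherical hyperbolas and ellipses with foci on the equator z = 0. *)
Definition type_II (R : realType) (q : conic R) : Prop :=
  match q with
  | CV A B => B < 1 < A \/ A < 1 < B
  | CH C D => D < C < 1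
  end.

(* Spherical ellipses with foci on the zero-meridian y = 0. *)
Definition type_III (R : realType) (q : conic R) : Prop :=
  match q with
  | CV _ _ => False
  | CH C D => C < 1 < D \/ C < D < 1
  end.

(* The condition defining a spherical parabola among the conics of type I. *)
Definition parabola_I (R : realType) (q : conic R) : Prop :=
  match q with
  | CV A B => (A ^+ 2 = 1 / 2 /\ B ^+ 2 < 1 / 2) \/
              (B ^+ 2 = 1 / 2 /\ A ^+ 2 < 1 / 2)
  | CH C D => C ^+ 2 + D ^+ 2 = 2 * C ^+ 2 * D ^+ 2
  end.

(* The condition defining a spherical parabola among the conics of type II. *)
Definition parabola_II (R : realType) (q : conic R) : Prop :=
  match q with
  | CV A B => A ^+ 2 + B ^+ 2 = 2 * A ^+ 2 * B ^+ 2
  | CH C D => C ^+ 2 = 1 / 2 /\ D ^+ 2 < 1 / 2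
  end.

(* Main.v *)
Require Import Defs.
From mathcomp Require Import all_boot all_order all_algebra.
From mathcomp Require Import all_classical all_reals all_analysis.
From mathcomp Require Import ring lra.

(** Whatever its family, an admissible conic is the intersection of the sphere
    with a single cylinder [a * x ^+ 2 + b * y ^+ 2 = 1] over a curve of the
    equatorial plane: for [CH C D] one eliminates [z ^+ 2] with the equation of
    the sphere, at the price of letting [a] or [b] be negative. In these
    coefficients [mu = (1 - a) * (b - 1)] and [c = a * b] for both families
    ([conic_muE], [conic_cE]), and all the claims become statements on the
    position of [a] and [b] relative to 0, 1 and 2.

    For the momentum, differentiating the equation of the cylinder says that
    [(x', y')] is proportional to [(b * y, - a * x)]; pairing with [(y, - x)]
    shows that the factor is exactly [K]. Differentiating the equation of the
    sphere then gives [z * z' = K * (a - b) * x * y], and unit speed becomes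
    [z ^+ 2 = K ^+ 2 * Q] where [Q] is a polynomial in [x ^+ 2], [y ^+ 2] and
    [z ^+ 2]; the two equations express it in [z ^+ 2] alone, and it is
    [(1 - a) * (b - 1) + a * b * z ^+ 2] ([cylinder_momentum]). The denominator
    cannot vanish: [Q = 0] forces [z = 0], hence [mu = 0], but no coefficient is 1.

    For the types, [mu + c = a + b - 1] and
    [(mu - c + 1) ^+ 2 + 4 * c * mu = (a - b) ^+ 2], so that type I means
    [a, b > 1], type II means that 1 separates two positive coefficients, and
    type III means that one coefficient is negative and the other exceeds 1.
    A type I parabola has 2 as its smaller coefficient; a type II
    parabola has [a + b = 2]. *)

Set Implicit Arguments.
Unset Strict Implicit.
Unset Printing Implicit Defensive.

Import Order.TTheory GRing.Theory Num.Theory.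
Import numFieldNormedType.Exports.

Local Open Scope ring_scope.
Local Open Scope classical_set_scope.

(** * Momentum of a spherical curve on a cylinder *)

(** A curve in a level set of a diagonal quadratic form has its velocity
    orthogonal to the gradient; used for the sphere and for the cylinder. *)
Lemma diagonal_quadric_tangent (R : realType) (I : set R) (x y z : R -> R)
    (a b e k s : R) :
  open I -> I s -> derivable x s 1 -> derivable y s 1 -> derivable z s 1 ->
  (forall t, I t -> a * x t ^+ 2 + b * y t ^+ 2 + e * z t ^+ 2 = k) ->
  a * (x s * derive1 x s) + b * (y s * derive1 y s)
    + e * (z s * derive1 z s) = 0.
Proof.
move=> oI Is dx dy dz level.
have sq (f : R -> R) (r : R) : derivable f s 1 ->
    is_derive s 1 (r \*: (f * f)) (r *: (f s *: 'D_1 f s + f s *: 'D_1 f s)).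
  by move=> /derivableP df; apply: is_deriveZ; apply: is_deriveM.
have dq := is_deriveD (is_deriveD (sq x a dx) (sq y b dy)) (sq z e dz).
have dcst : is_derive s 1 (cst k : R -> R) 0 by exact: is_derive_cst.
have near_level : \forall t \near s,
    (a \*: (x * x) + b \*: (y * y) + e \*: (z * z)) t = cst k t.
  near=> t; rewrite /= -(level t); last by near: t; exact: open_nbhs_nbhs.
  by rewrite !expr2.
have := near_eq_is_derive near_level dq.
move=> /@derive_val; rewrite (@derive_val _ _ _ _ _ _ _ dcst).
rewrite !derive1E /GRing.scale /= => eq0; lra.
Unshelve. all: by end_near.
Qed.

(** Two tangency conditions and unit length determine the velocity up to sign,
    hence [K ^+ 2]. The relation is kept as a product: it then shows by itself
    that the second factor can vanish only on the equator. *)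
Lemma cylinder_momentum (F : comPzRingType) (a b x y z dx dy dz : F) :
  x ^+ 2 + y ^+ 2 + z ^+ 2 = 1 -> a * x ^+ 2 + b * y ^+ 2 = 1 ->
  dx ^+ 2 + dy ^+ 2 + dz ^+ 2 = 1 ->
  x * dx + y * dy + z * dz = 0 -> a * (x * dx) + b * (y * dy) = 0 ->
  z ^+ 2 = (dx * y - x * dy) ^+ 2 * ((1 - a) * (b - 1) + a * b * z ^+ 2).
Proof.
move=> sph cyl unit tsph tcyl; set K := dx * y - x * dy.
(* In [dx = dx * 1] the factor 1 is replaced by the equation of the cylinder;
   tangency trades the unwanted term for one with a factor [K]. *)
have ex : dx = K * b * y.
  rewrite -[LHS]mulr1 -cyl -[LHS]subr0 -(mulr0 x) -tcyl /K; ring.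
have ey : dy = - (K * a * x).
  rewrite -[LHS]mulr1 -cyl -[LHS]subr0 -(mulr0 y) -tcyl /K; ring.
have ez : z * dz = K * (a - b) * x * y.
  rewrite -[LHS]subr0 -tsph ex ey; ring.
transitivity (K ^+ 2 *
    (z ^+ 2 * (b ^+ 2 * y ^+ 2 + a ^+ 2 * x ^+ 2)
      + (a - b) ^+ 2 * x ^+ 2 * y ^+ 2)).
  transitivity (z ^+ 2 * (dx ^+ 2 + dy ^+ 2) + (z * dz) ^+ 2).
    rewrite -[LHS]mulr1 -unit; ring.
  rewrite ez ex ey; ring.
congr (_ * _).
have zE : z ^+ 2 = 1 - x ^+ 2 - y ^+ 2 by rewrite -sph; ring.
(* The equation of the cylinder turns the remaining discrepancy, a multiple of
   [a * x ^+ 2 + b * y ^+ 2 - 1], into 0. *)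
apply/eqP; rewrite -subr_eq0; apply/eqP.
transitivity ((a + b - 1 - (a * x ^+ 2 + b * y ^+ 2))
  * (a * x ^+ 2 + b * y ^+ 2 - 1)); first by rewrite zE; ring.
by rewrite cyl subrr mulr0.
Qed.

(** * Cylinder coefficients of a conic *)

(** For [CH C D], subtracting [D ^+ 2] times the given cylinder from the sphere
    eliminates [z ^+ 2], and dividing by [1 - D ^+ 2] normalizes the right-hand
    side; hence the coefficients below, of sign varying with [C] and [D]. *)
Definition cylinder_a (R : realType) (q : conic R) : R :=
  match q with
  | CV A B => 1 / A ^+ 2
  | CH C D => (C ^+ 2 - D ^+ 2) / (C ^+ 2 * (1 - D ^+ 2))
  end.

Definition cylinder_b (R : realType) (q : conic R) : R :=
  match q with
  | CV A B => 1 / B ^+ 2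
  | CH C D => 1 / (1 - D ^+ 2)
  end.

Lemma sqr_lt1 (R : realDomainType) (r : R) : 0 < r -> (r ^+ 2 < 1) = (r < 1).
Proof. by move=> r0; rewrite expr_lt1 // ltW. Qed.

Lemma sqr_gt1 (R : realDomainType) (r : R) : 0 < r -> (1 < r ^+ 2) = (1 < r).
Proof. by move=> r0; rewrite expr_gt1 // ltW. Qed.

Lemma one_sub_sqr_neq0 (R : realDomainType) (r : R) :
  0 < r -> r != 1 -> 1 - r ^+ 2 != 0.
Proof.
by move=> r0 r1; rewrite subr_eq0 eq_sym sqrp_eq1 // ltW.
Qed.

Lemma ltr_sqr_pos (R : realDomainType) (r t : R) :
  0 < r -> 0 < t -> (r ^+ 2 < t ^+ 2) = (r < t).
Proof. by move=> r0 t0; rewrite ltr_pXn2r // nnegrE ltW. Qed.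

Lemma conic_cylinder (R : realType) (q : conic R) (hq : admissible q)
    (x y z : R) : conic_set q (x, y, z) ->
  x ^+ 2 + y ^+ 2 + z ^+ 2 = 1 /\
  cylinder_a q * x ^+ 2 + cylinder_b q * y ^+ 2 = 1.
Proof.
case: q hq => [A B|C D] /= [A0 B0 [_ _ _ B1]] [/= sph cyl]; split=> //.
  by rewrite -[RHS]cyl; ring.
have D1 := one_sub_sqr_neq0 B0 B1.
have zE : z ^+ 2 = D ^+ 2 * (1 - x ^+ 2 / C ^+ 2).
  by rewrite -[in RHS]cyl; field; rewrite !gt_eqF.
have yE : y ^+ 2 = 1 - x ^+ 2 - z ^+ 2 by rewrite -sph; ring.
by rewrite yE zE; field; rewrite gt_eqF.
Qed.

Lemma conic_muE (R : realType) (q : conic R) (hq : admissible q) :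
  conic_mu q = (1 - cylinder_a q) * (cylinder_b q - 1).
Proof.
case: q hq => [A B|C D] /= [A0 B0 [_ _ _ B1]]; field.
  by rewrite !gt_eqF.
by rewrite one_sub_sqr_neq0 // gt_eqF.
Qed.

Lemma conic_cE (R : realType) (q : conic R) (hq : admissible q) :
  conic_c q = cylinder_a q * cylinder_b q.
Proof.
case: q hq => [A B|C D] /= [A0 B0 [_ _ _ B1]]; field.
  by rewrite !gt_eqF.
by rewrite one_sub_sqr_neq0 // gt_eqF.
Qed.

(** The coefficients of [CV A B] are inverse squares, so they compare with 1 in
    the order opposite to [A] and [B]. For [CH C D], [b > 1] amounts to [D < 1],
    and then [a > 1] amounts to [C > 1]. *)
Lemma type_I_coefs (R : realType) (q : conic R) (hq : admissible q) :
  type_I q ->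
  [/\ 1 < cylinder_a q, 1 < cylinder_b q & cylinder_a q != cylinder_b q].
Proof.
case: q hq => [A B|C D] /= [A0 B0 [_ AB A1 B1]].
  have sA : 0 < A ^+ 2 by rewrite exprn_gt0.
  have sB : 0 < B ^+ 2 by rewrite exprn_gt0.
  move=> h; have {h} [Al Bl] : A < 1 /\ B < 1 by case: h => /andP[? ?]; lra.
  split; rewrite ?ltr_pdivlMr ?mul1r ?sqr_lt1 //.
  by rewrite (inj_eq invr_inj) eqrXn2 // ltW.
move=> /andP[Dl Cg].
have sC : 1 < C ^+ 2 by rewrite sqr_gt1.
have sD : D ^+ 2 < 1 by rewrite sqr_lt1.
have sD0 : 0 < D ^+ 2 by rewrite exprn_gt0.
have d0 : 0 < 1 - D ^+ 2 by lra.
have m0 : 0 < C ^+ 2 * (1 - D ^+ 2) by rewrite mulr_gt0 //; lra.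
split; first by rewrite ltr_pdivlMr //; nra.
  by rewrite ltr_pdivlMr //; lra.
by rewrite lt_eqF // ltr_pdivrMr // mulrCA divfK ?gt_eqF // mulr1; lra.
Qed.

Lemma parabola_I_coefs (R : realType) (q : conic R) (hq : admissible q) :
  type_I q -> parabola_I q ->
  (cylinder_a q = 2 /\ 2 < cylinder_b q) \/
  (cylinder_b q = 2 /\ 2 < cylinder_a q).
Proof.
case: q hq => [A B|C D] /= [A0 B0 [_ _ _ B1]].
  have sA : 0 < A ^+ 2 by rewrite exprn_gt0.
  have sB : 0 < B ^+ 2 by rewrite exprn_gt0.
  move=> _ [] [e l]; [left|right]; (split; first by rewrite e; field);
    rewrite ltr_pdivlMr //; lra.
move=> /andP[Dl Cg] par; left.
have sC : 1 < C ^+ 2 by rewrite sqr_gt1.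
have sD : D ^+ 2 < 1 by rewrite sqr_lt1.
have d0 : 0 < 1 - D ^+ 2 by lra.
have m0 : 0 < C ^+ 2 * (1 - D ^+ 2) by rewrite mulr_gt0 //; lra.
split; last by rewrite ltr_pdivlMr //; nra.
have -> : C ^+ 2 - D ^+ 2 = 2 * (C ^+ 2 * (1 - D ^+ 2)) by lra.
by rewrite mulfK // gt_eqF.
Qed.

Lemma type_II_coefs (R : realType) (q : conic R) (hq : admissible q) :
  type_II q ->
  0 < cylinder_a q < 1 /\ 1 < cylinder_b q \/
  0 < cylinder_b q < 1 /\ 1 < cylinder_a q.
Proof.
case: q hq => [A B|C D] /= [A0 B0 [_ _ _ B1]].
  have sA : 0 < A ^+ 2 by rewrite exprn_gt0.
  have sB : 0 < B ^+ 2 by rewrite exprn_gt0.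
  move=> [] /andP[l g]; [left|right];
  by rewrite divr_gt0 //= ltr_pdivrMr // ltr_pdivlMr // !mul1r
    sqr_lt1 // sqr_gt1.
move=> /andP[DC Cl]; left.
have sC : C ^+ 2 < 1 by rewrite sqr_lt1.
have sDC : D ^+ 2 < C ^+ 2 by rewrite ltr_sqr_pos.
have sD0 : 0 < D ^+ 2 by rewrite exprn_gt0.
have d0 : 0 < 1 - D ^+ 2 by lra.
have m0 : 0 < C ^+ 2 * (1 - D ^+ 2) by rewrite mulr_gt0 //; lra.
rewrite divr_gt0 ?subr_gt0 //=.
by rewrite ltr_pdivrMr // ltr_pdivlMr //; split; nra.
Qed.

Lemma parabola_II_coefs (R : realType) (q : conic R) (hq : admissible q) :
  parabola_II q -> cylinder_a q + cylinder_b q = 2.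
Proof.
case: q hq => [A B|C D] /= [A0 B0 [_ _ _ B1]].
  move=> par; have -> : 1 / A ^+ 2 + 1 / B ^+ 2
      = (A ^+ 2 + B ^+ 2) / (A ^+ 2 * B ^+ 2).
    by field; rewrite !gt_eqF.
  by rewrite par; field; rewrite !gt_eqF.
have D1 := one_sub_sqr_neq0 B0 B1.
by move=> [-> _]; field; rewrite D1.
Qed.

(** The two kinds of [CH C D] differ by exchanging [a] and [b]: the sign of
    [1 - D ^+ 2] decides which coefficient is negative. *)
Lemma type_III_coefs (R : realType) (q : conic R) (hq : admissible q) :
  type_III q ->
  cylinder_a q < 0 /\ 1 < cylinder_b q \/
  cylinder_b q < 0 /\ 1 < cylinder_a q.
Proof.
case: q hq => [A B|C D] //= [C0 D0 [_ _ _ D1]].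
have sC0 : 0 < C ^+ 2 by rewrite exprn_gt0.
have sD0 : 0 < D ^+ 2 by rewrite exprn_gt0.
case=> /andP[l g]; [right|left].
  have sC : C ^+ 2 < 1 by rewrite sqr_lt1.
  have sD : 1 < D ^+ 2 by rewrite sqr_gt1.
  have d0 : 1 - D ^+ 2 < 0 by lra.
  have m0 : C ^+ 2 * (1 - D ^+ 2) < 0 by rewrite pmulr_rlt0.
  split; first by rewrite div1r invr_lt0.
  by rewrite ltr_ndivlMr //; nra.
have sD : D ^+ 2 < 1 by rewrite sqr_lt1.
have sCD : C ^+ 2 < D ^+ 2 by rewrite ltr_sqr_pos.
have d0 : 0 < 1 - D ^+ 2 by lra.
have m0 : 0 < C ^+ 2 * (1 - D ^+ 2) by rewrite mulr_gt0.
split; first by rewrite ltr_pdivrMr // mul0r subr_lt0.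
by rewrite ltr_pdivlMr //; lra.
Qed.

(** The types exhaust the admissible conics, so that [mu] and [c] are nonzero
    because their signs are known in each type. *)
Lemma admissible_type (R : realType) (q : conic R) (hq : admissible q) :
  [\/ type_I q, type_II q | type_III q].
Proof.
case: q hq => [A B|C D] /= [C0 D0 [+ CD C1 D1]]; rewrite gt_min.
  case: (ltgtP A 1) C1 => // hA _; case: (ltgtP B 1) D1 => // hB _ _.
  - apply: Or31; case: (ltgtP A B) CD => // h _; [right|left]; exact/andP.
  - by apply: Or32; right.
  - by apply: Or32; left.
case: (ltgtP C 1) C1 => // hC _; case: (ltgtP D 1) D1 => // hD _ _.
- case: (ltgtP C D) CD => // h _; first by apply: Or33; right.
  exact: Or32.
- by apply: Or33; left.
- exact: Or31.
Qed.

(** * The proposition *)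

Theorem proposition4p7 (R : realType) (q : conic R) (hq : admissible q) :
  let mu := conic_mu q in
  let c := conic_c q in
  [/\ mu != 0, c != 0 &
      forall (I : set R) (x y z : R -> R),
        unit_speed_curve I x y z ->
        (forall s, I s -> conic_set q (x s, y s, z s)) ->
        forall s, I s ->
          mu + c * z s ^+ 2 != 0 /\
          angular_momentum x y s ^+ 2 = z s ^+ 2 / (mu + c * z s ^+ 2)]
  /\
  [/\ type_I q ->
        [/\ mu < 0, mu + c > 1 & (mu - c + 1) ^+ 2 + 4 * c * mu > 0] /\
        (parabola_I q -> 2 * mu + c = 2 /\ c > 4),
      type_II q ->
        [/\ mu > 0 & c > 0] /\ (parabola_II q -> mu + c = 1) &
      type_III q -> mu > 0 /\ c < 0].
Proof.
rewrite /= conic_muE // conic_cE //.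
have tI := type_I_coefs hq; have pI := parabola_I_coefs hq.
have tII := type_II_coefs hq; have pII := parabola_II_coefs hq.
have tIII := type_III_coefs hq; have on_cylinder := conic_cylinder hq.
have types := admissible_type hq.
set a := cylinder_a q in tI pI tII pII tIII on_cylinder *.
set b := cylinder_b q in tI pI tII pII tIII on_cylinder *.
have signI : type_I q -> (1 - a) * (b - 1) < 0 /\ a * b > 0.
  by move=> /tI[a1 b1 _]; split; nra.
have signII : type_II q -> (1 - a) * (b - 1) > 0 /\ a * b > 0.
  by move=> /tII[] [/andP[? ?] ?]; split; nra.
have signIII : type_III q -> (1 - a) * (b - 1) > 0 /\ a * b < 0.
  by move=> /tIII[] [? ?]; split; nra.
have [mu0 c0] : (1 - a) * (b - 1) != 0 /\ a * b != 0.
  by case: types => [/signI|/signII|/signIII] [? ?]; split;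
    apply/eqP; lra.
split; split=> //.
- move=> I x y z [oI _ curve] on_conic s Is.
  have [dx dy dz /= sph unit] := curve s Is.
  have [_ cyl] := on_cylinder _ _ _ (on_conic s Is).
  have tsph : x s * derive1 x s + y s * derive1 y s + z s * derive1 z s = 0.
    rewrite -(diagonal_quadric_tangent (a := 1) (b := 1) (e := 1) (k := 1)
      oI Is dx dy dz); first by rewrite !mul1r.
    by move=> t It; have [? _] := on_cylinder _ _ _ (on_conic t It);
      rewrite !mul1r.
  have tcyl : a * (x s * derive1 x s) + b * (y s * derive1 y s) = 0.
    rewrite -(diagonal_quadric_tangent (a := a) (b := b) (e := 0) (k := 1)
      oI Is dx dy dz); first by rewrite mul0r addr0.
    by move=> t It; have [_ ?] := on_cylinder _ _ _ (on_conic t It);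
      rewrite mul0r addr0.
  have main := cylinder_momentum sph cyl unit tsph tcyl.
  have den0 : (1 - a) * (b - 1) + a * b * z s ^+ 2 != 0.
    apply/eqP => den; move: main mu0; rewrite den mulr0 => z0.
    by move: den; rewrite z0 mulr0 addr0 => ->; rewrite eqxx.
  by split=> //; rewrite {1}main mulfK.
- move=> hI; have [a1 b1 ab] := tI hI; have [? _] := signI hI; split.
    split=> //; first by lra.
    have -> : ((1 - a) * (b - 1) - a * b + 1) ^+ 2
        + 4 * (a * b) * ((1 - a) * (b - 1)) = (a - b) ^+ 2 by ring.
    by rewrite exprn_even_gt0 //= subr_eq0.
  by move=> /(pI hI)[] [-> ?]; split; lra.
- move=> hII; split; first exact: signII.
  by move=> /pII ab; lra.
Qed.
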